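(* Suppose that a group $G$ is finitely presented with respect to a collection of subgroups $\{H_\lambda\}_{\lambda\in\Lambda}$ and that the relative Dehn function $\delta^{rel}_G$ of $G$ with respect to $\{H_\lambda\}_{\lambda\in\Lambda}$ is well-defined. Then the following conditions are equivalent. 1) $\delta^{rel}_G$ is subquadratic. 2) $\delta^{rel}_G$ is linear.
   Context: A subset $X\subseteq G$ is a relative generating set of $G$ with respect to $\{H_\lambda\}_{\lambda\in\Lambda}$ if $G$ is generated by $X\cup\bigcup_{\lambda\in\Lambda}H_\lambda$. In this case put $F=(\ast_{\lambda\in\Lambda}\widetilde H_\lambda)\ast F(X)$, where $\widetilde H_\lambda$ is an isomorphic copy of $H_\lambda$ and $F(X)$ is the free group with basis $X$, let $\varepsilon:F\to G$ be the canonical epimorphism, and let $\mathcal H=\bigsqcup_{\lambda\in\Lambda}(\widetilde H_\lambda\setminus\{1\})$. $G$ has the relative presentation $\langle X, H_\lambda,\lambda\in\Lambda \mid R=1, R\in\mathcal R\rangle$, where $\mathcal R$ is a set of words over $X^{\pm1}\cup\mathcal H$ (viewed as elements of $F$, closed under cyclic shifts and inverses), if $\ker\varepsilon$ is the normal closure of $\mathcal R$ in $F$. It is finite if both $X$ and $\mathcal R$ are finite. $G$ is finitely presented with respect to $\{H_\lambda\}$ if it admits a finite relative presentation. A function $f:\mathbb N\to\mathbb N$ is a relative isoperimetric function of a finite relative presentation if for every $n$ and every word $W$ over $X^{\pm1}\cup\mathcal H$ of length at most $n$ representing $1$ in $G$, there is an equality $W=\prod_{i=1}^k f_i^{-1}R_if_i$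 in $F$ with $R_i\in\mathcal R$, $f_i\in F$, $k\le f(n)$. The smallest one is the relative Dehn function $\delta_G^{rel}$ of $G$ with respect to $\{H_\lambda\}$; it is well-defined if it is finite at every $n$. It is considered up to the equivalence $f\sim g$ iff $f\preceq g$ and $g\preceq f$, where $f\preceq g$ means $f(n)\le Cg(Kn)+Ln$ for some constants $C,K,L\in\mathbb N$ and all $n$; up to this equivalence it does not depend on the finite relative presentation. A function $f:\mathbb N\to\mathbb N$ is subquadratic if $f(n)=o(n^2)$ as $n\to\infty$; $\delta_G^{rel}$ is linear if it is bounded from above by $Ln$ for some constant $L$. *)

(* Defs.v *)
From HB Require Import structures.
From mathcomp Require Import all_boot all_order all_algebra.
From mathcomp Require Import generic_quotient.
From mathcomp Require Import all_classical all_reals.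
From mathcomp Require Import topology normedtype sequences landau.
Import Order.TTheory GRing.Theory Num.Theory.
Import numFieldNormedType.Exports.

Set Implicit Arguments.
Unset Strict Implicit.
Unset Printing Implicit Defensive.

Local Open Scope classical_set_scope.
Local Open Scope quotient_scope.
Local Open Scope group_scope.

Section SubgroupType.
Variables (G : groupType) (S : groupClosed G).

Definition subgroup_type : Type := {x : G | x \in S}.

HB.instance Definition _ := SubChoice.on subgroup_type.

Fact subgroup_type_closed : group_closed [in S].
Proof. by split=> [|x y xS yS]; [exact: gpred1 | exact: gpredF]. Qed.

HB.instance Definition _ :=
  SubChoice_isSubGroup.Build G [in S] subgroup_type subgroup_type_closed.

End SubgroupType.

Section NormalClosure.
Variable G : groupType.

Definition is_subgroup (N : set G) : Prop := group_closed [in N].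

Definition is_normal_subgroup (N : set G) : Prop :=
  is_subgroup N /\ forall x y : G, N x -> N (x ^ y).

Definition generated_subgroup (A : set G) : set G := smallest is_subgroup A.

Definition normal_closure (A : set G) : set G := smallest is_normal_subgroup A.

End NormalClosure.

Section FreeProduct.
Variables (I : Type) (K : I -> groupType) (X : Type).

Inductive letter : Type :=
  | Gen (x : X) (inverted : bool)
  | Per (i : I) (h : {h : K i | h != 1}).

HB.instance Definition _ := gen_eqMixin letter.
HB.instance Definition _ := gen_choiceMixin letter.

Definition word : Type := seq letter.

HB.instance Definition _ := Choice.on word.

Fact nonunitV_subproof i (h : {h : K i | h != 1}) : (val h)^-1 != 1.
Proof. by rewrite invg_eq1 (valP h). Qed.

Definition nonunitV i (h : {h : K i | h != 1}) : {h : K i | h != 1} :=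
  exist _ (val h)^-1 (nonunitV_subproof h).

Definition letterV (a : letter) : letter :=
  match a with Gen x b => Gen x (~~ b) | Per i h => Per (nonunitV h) end.

Definition wordV (w : word) : word := rev (map letterV w).

(* The word of length at most one that spells an element of a factor. *)
Definition spell (i : I) (h : K i) : word :=
  if insub h is Some h' then [:: Per h'] else [::].

(* Equality in the free product: the least monoid congruence on words for
   which [Gen x true] is inverse to [Gen x false] and letters of the same
   factor multiply as they do in that factor. *)
Inductive eqF : word -> word -> Prop :=
  | eqF_refl w : eqF w w
  | eqF_sym u v : eqF u v -> eqF v u
  | eqF_trans u v w : eqF u v -> eqF v w -> eqF u w
  | eqF_cat u u' v v' : eqF u u' -> eqF v v' -> eqF (u ++ v) (u' ++ v')
  | eqF_gen x b : eqF [:: Gen x b; Gen x (~~ b)] [::]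
  | eqF_per i (h k : K i) : eqF (spell h ++ spell k) (spell (h * k)).

Definition eqFb (u v : word) : bool := `[< eqF u v >].

Fact eqFb_equiv : equiv_class_of eqFb.
Proof.
split=> [w|u v|v u w].
- exact/asboolP/eqF_refl.
- by apply/asboolP/asboolP; exact: eqF_sym.
- by move=> /asboolP uv /asboolP vw; apply/asboolP; exact: eqF_trans uv vw.
Qed.

Canonical eqFb_equiv_rel := EquivRelPack eqFb_equiv.

(* (free product of the K i) * (free group with basis X) *)
Definition freeprod : Type := {eq_quot eqFb}.

HB.instance Definition _ := Choice.on freeprod.
HB.instance Definition _ := EqQuotient.on freeprod.

Definition of_word (w : word) : freeprod := \pi_freeprod w.

Lemma of_wordP u v : of_word u = of_word v <-> eqF u v.
Proof.
split=> [/eqquotP/asboolP//|uv]; exact/eqquotP/asboolP.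
Qed.

Lemma repr_of_word u : eqF (repr (of_word u)) u.
Proof. by apply/of_wordP; rewrite /of_word reprK. Qed.

Lemma of_word_repr (f : freeprod) : of_word (repr f) = f.
Proof. exact: reprK. Qed.

Definition freeprod1 : freeprod := of_word [::].
Definition freeprodM (f g : freeprod) : freeprod := of_word (repr f ++ repr g).
Definition freeprodV (f : freeprod) : freeprod := of_word (wordV (repr f)).

Lemma spell_val i (h : {h : K i | h != 1}) : spell (val h) = [:: Per h].
Proof. by rewrite /spell valK. Qed.

Lemma spell1 i : spell (1 : K i) = [::].
Proof. by rewrite /spell insubF ?eqxx. Qed.

Lemma letterVK : involutive letterV.
Proof.
case=> [x b|i h] /=; first by rewrite negbK.
by congr Per; apply: val_inj; rewrite /= invgK.
Qed.

Lemma wordVK : involutive wordV.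
Proof. by move=> w; rewrite /wordV map_rev revK mapK //; exact: letterVK. Qed.

Lemma wordV_cat u v : wordV (u ++ v) = wordV v ++ wordV u.
Proof. by rewrite /wordV map_cat rev_cat. Qed.

Lemma eqF_letter a : eqF [:: a; letterV a] [::].
Proof.
case: a => [x b|i h] /=; first exact: eqF_gen.
have := eqF_per (val h) (val (nonunitV h)).
by rewrite !spell_val /= mulgV spell1.
Qed.

Lemma eqF_mulV w : eqF (w ++ wordV w) [::].
Proof.
elim: w => [|a w IHw]; first exact: eqF_refl.
rewrite -cat1s wordV_cat catA -(catA [:: a]).
apply: eqF_trans (eqF_letter a).
rewrite -[[:: a; _]]/([:: a] ++ wordV [:: a]).
apply: eqF_cat (eqF_refl _); rewrite -[X in eqF _ X]cats0.
exact: eqF_cat (eqF_refl _) IHw.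
Qed.

Lemma of_word_cat u v : of_word (u ++ v) = freeprodM (of_word u) (of_word v).
Proof.
by apply/of_wordP/eqF_sym/eqF_cat; exact: repr_of_word.
Qed.

Fact freeprodA : associative freeprodM.
Proof.
move=> f g h; rewrite -(of_word_repr f) -(of_word_repr g) -(of_word_repr h).
by rewrite -!of_word_cat catA.
Qed.

Fact freeprod1M : left_id freeprod1 freeprodM.
Proof. by move=> f; rewrite -(of_word_repr f) -of_word_cat. Qed.

Fact freeprodM1 : right_id freeprod1 freeprodM.
Proof. by move=> f; rewrite -(of_word_repr f) -of_word_cat cats0. Qed.

Fact freeprodMV : right_inverse freeprod1 freeprodV freeprodM.
Proof.
move=> f; rewrite -{1}(of_word_repr f) -of_word_cat.
exact/of_wordP/eqF_mulV.
Qed.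

Fact freeprodVM : left_inverse freeprod1 freeprodV freeprodM.
Proof.
move=> f; rewrite -{2}(of_word_repr f) -of_word_cat.
by rewrite -{2}(wordVK (repr f)); exact/of_wordP/eqF_mulV.
Qed.

HB.instance Definition _ := isGroup.Build freeprod
  freeprodA freeprod1M freeprodM1 freeprodVM freeprodMV.

Lemma of_wordM u v : of_word (u ++ v) = of_word u * of_word v.
Proof. exact: of_word_cat. Qed.

Section UniversalProperty.
Variables (L : groupType) (phi : forall i, UMagmaMorphism.type (K i) L).
Variable psi : X -> L.

Definition eval_letter (a : letter) : L :=
  match a with
  | Gen x b => if b then (psi x)^-1 else psi x
  | Per i h => phi i (val h)
  end.

Definition eval_word (w : word) : L := \prod_(a <- w) eval_letter a.

Definition lift (f : freeprod) : L := eval_word (repr f).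

Lemma eval_word_cat u v : eval_word (u ++ v) = eval_word u * eval_word v.
Proof. exact: big_cat. Qed.

Lemma eval_spell i (h : K i) : eval_word (spell h) = phi i h.
Proof.
rewrite /spell; case: insubP => [h' _ <-|]; first exact: big_seq1.
by rewrite negbK => /eqP->; rewrite gmulf1 /eval_word big_nil.
Qed.

Lemma eval_eqF u v : eqF u v -> eval_word u = eval_word v.
Proof.
elim=> {u v} // [u v w _ -> _ -> //|u u' v v' _ IHu _ IHv|x b|i h k].
- by rewrite !eval_word_cat IHu IHv.
- by rewrite /eval_word big_cons big_seq1 big_nil; case: b; rewrite /= ?mulgV ?mulVg.
- by rewrite eval_word_cat !eval_spell gmulfM.
Qed.

Lemma lift_of_word w : lift (of_word w) = eval_word w.
Proof. exact/eval_eqF/repr_of_word. Qed.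

Fact lift_morphism : monoid.monoid_morphism lift.
Proof.
split=> [|f g]; first by rewrite lift_of_word /eval_word big_nil.
rewrite -(of_word_repr f) -(of_word_repr g) -of_wordM.
by rewrite !lift_of_word eval_word_cat.
Qed.

HB.instance Definition _ :=
  isUMagmaMorphism.Build freeprod L lift lift_morphism.

End UniversalProperty.

Fact spell_morphism i : monoid.monoid_morphism (fun h : K i => of_word (spell h)).
Proof.
by split=> [|h k]; rewrite ?spell1 // -of_wordM; exact/of_wordP/eqF_sym/eqF_per.
Qed.

Definition incl_per i (h : K i) : freeprod := of_word (spell h).

HB.instance Definition _ i :=
  isUMagmaMorphism.Build (K i) freeprod (@incl_per i) (spell_morphism i).

Definition incl_gen (x : X) : freeprod := of_word [:: Gen x false].

(* The universal property of the free product, for the two inclusions above. *)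
Theorem freeprod_universal (L : groupType)
    (phi : forall i, UMagmaMorphism.type (K i) L) (psi : X -> L) :
  [/\ forall i (h : K i), lift phi psi (incl_per h) = phi i h,
      forall x, lift phi psi (incl_gen x) = psi x
    & forall f : UMagmaMorphism.type freeprod L,
        (forall i (h : K i), f (incl_per h) = phi i h) ->
        (forall x, f (incl_gen x) = psi x) ->
      f =1 lift phi psi].
Proof.
split=> [i h|x|f fphi fpsi g]; rewrite ?lift_of_word ?eval_spell //.
  exact: big_seq1.
rewrite -(of_word_repr g) lift_of_word; elim: (repr g) => [|a w IHw].
  by rewrite /eval_word big_nil -[RHS](gmulf1 (s := f)).
rewrite -cat1s of_wordM gmulfM IHw eval_word_cat; congr (_ * _).
rewrite /eval_word big_seq1; case: a => [x [|]|i h] /=.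
- apply: (mulIg (psi x)); rewrite mulVg -[X in _ * X]fpsi -gmulfM -of_wordM.
  by rewrite -[RHS](gmulf1 (s := f)); congr (f _); exact/of_wordP/(eqF_gen x true).
- exact: fpsi.
- by rewrite -spell_val fphi.
Qed.

End FreeProduct.

Arguments freeprod {I} K X.
Arguments word {I} K X.
Arguments of_word {I K X} w.

Section RelativePresentation.
Variables (G : groupType) (Lam : Type) (H : Lam -> groupClosed G).

Definition peripheral (l : Lam) : groupType := subgroup_type (H l).

Definition is_relative_generating_set (X : set G) : Prop :=
  generated_subgroup (X `|` \bigcup_l [set x | x \in H l]) = setT.

Section CanonicalMap.
Variable X : set G.

Definition relF : groupType := freeprod peripheral X.
Definition relword : Type := word peripheral X.

Definition eps : relF -> G :=
  lift (fun l => \val : UMagmaMorphism.type (peripheral l) G)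
       (fun x : X => \val x).

HB.instance Definition _ := UMagmaMorphism.on eps.

End CanonicalMap.

Record relative_presentation := RelativePresentation {
  rp_gen : set G;
  rp_rel : set (relword rp_gen);
  rp_generating : is_relative_generating_set rp_gen;
  rp_rot : forall (n : nat) w, rp_rel w -> rp_rel (rot n w);
  rp_inv : forall w, rp_rel w -> rp_rel (wordV w);
  rp_ker : [set f : relF rp_gen | eps f = 1] = normal_closure (of_word @` rp_rel)
}.

Definition finite_presentation (P : relative_presentation) : Prop :=
  finite_set (rp_gen P) /\ finite_set (rp_rel (r := P)).

Section DehnFunction.
Variable P : relative_presentation.

Definition represents1 (w : relword (rp_gen P)) : Prop := eps (of_word w) = 1.

(* Each pair of [s] is a conjugator f_i in F followed by a relator R_i. *)
Definition area_le (w : relword (rp_gen P)) (k : nat) : Prop :=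
  exists s : seq (relF (rp_gen P) * relword (rp_gen P)),
    [/\ (size s <= k)%N,
        forall p, p \in s -> rp_rel p.2
      & of_word w = \prod_(p <- s) (p.1^-1 * of_word p.2 * p.1)].

Definition relative_isoperimetric (f : nat -> nat) : Prop :=
  forall (n : nat) (w : relword (rp_gen P)),
    (size w <= n)%N -> represents1 w -> area_le w (f n).

(* The relative Dehn function of [P] is well-defined exactly when some
   [d : nat -> nat] satisfies this predicate, and [d] is then unique. *)
Definition is_relative_dehn (d : nat -> nat) : Prop :=
  relative_isoperimetric d /\
  forall f, relative_isoperimetric f -> forall n, (d n <= f n)%N.

End DehnFunction.

End RelativePresentation.

Definition dehn_preceq (f g : nat -> nat) : Prop :=
  exists C K L : nat, forall n, (f n <= C * g (K * n) + L * n)%N.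

Definition dehn_equiv (f g : nat -> nat) : Prop :=
  dehn_preceq f g /\ dehn_preceq g f.

Definition subquadratic (R : realType) (f : nat -> nat) : Prop :=
  (fun n => (f n)%:R : R)%R =o_\oo (fun n => n%:R ^+ 2 : R)%R.

Definition linearly_bounded (f : nat -> nat) : Prop :=
  exists L : nat, forall n, (f n <= L * n)%N.

(* Main.v *)
(* A subquadratic isoperimetric inequality implies a linear one, following
   Bowditch: if a loop of length [n] and area [k] is cut into four sides of
   length about [n/4], two opposite sides are joined by a path of length
   [O(sqrt k)], which is [o(n)]; this path splits the loop into two loops of
   total length [n + O(sqrt k)], each shorter by a definite factor, and the
   resulting recursion forces [k <= A n - E sqrt n].

   The shortcut comes from the inequality [t1 t2 <= C k], where [t1] and [t2]
   are lower bounds for the distances between opposite sides.  No planar diagram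
   is needed: let [f] and [g] be the distances to two adjacent sides, truncated
   at [t1] and [t2].  Then [f dg] has integral [t1 t2] along the loop, whereas
   it is additive on [F] and bounded on each relator, so its integral along a
   product of [k] conjugates of relators is at most [C k]. *)

Require Import Defs.
From mathcomp Require Import all_boot all_order all_algebra.
From mathcomp Require Import all_classical all_reals.
From mathcomp Require Import topology normedtype sequences landau.
From mathcomp Require Import zify ring lra.

Set Implicit Arguments.
Unset Strict Implicit.
Unset Printing Implicit Defensive.

Import Order.TTheory GRing.Theory Num.Theory.
Import numFieldNormedType.Exports.

Local Open Scope classical_set_scope.
Local Open Scope group_scope.

(** * Truncated minima and their Lipschitz property *)

Section TruncatedMinimum.
Variable t : nat.
Implicit Type Q : nat -> Prop.

(* The least [j] with [Q j], truncated at [t], when [Q] is upward closed. *)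
Definition truncmin Q : int := Posz (\sum_(j < t) ~~ `[< Q j >])%N.

Lemma truncmin0 Q : (forall j, Q j) -> truncmin Q = 0%R.
Proof.
by move=> hQ; rewrite /truncmin big1 // => j _; rewrite asboolT.
Qed.

Lemma truncmin_max Q : (forall j, (j < t)%N -> ~ Q j) -> truncmin Q = Posz t.
Proof.
move=> hQ; rewrite /truncmin;
congr Posz; rewrite (eq_bigr (fun=> 1%N)); first by rewrite sum1_card card_ord.
by move=> j _; rewrite asboolF //; exact: hQ.
Qed.

(** Term [j.+1] of the sum for [Q'] is at most term [j] of the sum for [Q]; only the initial term
    for [Q'] is left over, and it costs at most 1. *)
Lemma truncmin_lip Q Q' :
  (forall j, Q j -> Q' j.+1) -> (truncmin Q' <= truncmin Q + 1)%R.
Proof.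
move=> hQ; suff: (\sum_(j < t) ~~ `[< Q' j >] <= \sum_(j < t) ~~ `[< Q j >] + 1)%N.
  by rewrite /truncmin; lia.
case: t => [|n]; first by rewrite !big_ord0.
rewrite big_ord_recl /= big_ord_recr /= addnC -addnA leq_add //.
  apply: leq_sum => j _; rewrite /bump leq0n add1n.
  by case: asboolP => // hj; case: asboolP => // /hQ.
by case: asboolP => //=; rewrite ?leq_addl.
Qed.

End TruncatedMinimum.

(** * The integral of [f dg] along words *)

Section WordIntegral.
Variables (I : Type) (K : I -> groupType) (X : Type) (L : groupType).
Variables (phi : forall i, UMagmaMorphism.type (K i) L) (psi : X -> L).
Local Notation ev := (eval_word phi psi).

Lemma eval_cons a (w : word K X) : ev (a :: w) = eval_letter phi psi a * ev w.
Proof. exact: big_cons. Qed.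

Lemma eval_nil : ev ([::] : word K X) = 1.
Proof. exact: big_nil. Qed.

Lemma eval_wordV (w : word K X) : ev (wordV w) = (ev w)^-1.
Proof.
apply: (mulgI (ev w)); rewrite mulgV -eval_word_cat -eval_nil.
exact/eval_eqF/eqF_mulV.
Qed.

Section Integral.
Variables (f g : L -> int) (fc gc : I -> L -> int).
Hypothesis fcH : forall i p (h : K i), fc i (p * phi i h) = fc i p.
Hypothesis gcH : forall i p (h : K i), gc i (p * phi i h) = gc i p.

(* Twice the integral of [f dg] along one edge.  An edge labelled by an element
   of [K i] is routed through a cone point over its coset, which makes the
   integral additive under multiplication in [K i]. *)
Definition integral_letter (p : L) (a : letter K X) : int :=
  let q := p * eval_letter phi psi a in
  match a with
  | Gen _ _ => (f p + f q) * (g q - g p)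
  | Per i _ => (f p + fc i p) * (gc i p - g p) + (fc i p + f q) * (g q - gc i p)
  end%R.

Fixpoint integral (p : L) (w : word K X) : int :=
  if w is a :: w' then
    (integral_letter p a + integral (p * eval_letter phi psi a)%g w')%R
  else 0%R.

Lemma integral_cat p u v :
  integral p (u ++ v) = (integral p u + integral (p * ev u)%g v)%R.
Proof.
elim: u p => [|a u IHu] p /=; first by rewrite eval_nil mulg1 add0r.
by rewrite IHu eval_cons mulgA addrA.
Qed.

Lemma integral_spell p i (h : K i) :
  integral p (spell X h) =
    ((f p + fc i p) * (gc i p - g p) +
     (fc i p + f (p * phi i h)%g) * (g (p * phi i h)%g - gc i p))%R.
Proof.
rewrite /spell; case: insubP => [h' _ <- /=|]; first by rewrite addr0.
by rewrite negbK => /eqP->; rewrite gmulf1 mulg1 /=; ring.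
Qed.

(** An edge and its reverse cancel. For two letters of one factor, the way down from the cone point
    after the first letter cancels the way back up before the second, since [fc] and [gc] are
    constant on the coset. *)
Lemma integral_eqF p u v : eqF u v -> integral p u = integral p v.
Proof.
move=> uv.
elim: uv p => {u v}
  [|u v _ IH|u v w _ IH _ IH'|u u' v v' uu' IH _ IH'|x b|i h k] p //.
- by rewrite IH.
- by rewrite !integral_cat IH IH' (eval_eqF phi psi uu').
- have -> : integral p [:: Gen K x b; Gen K x (~~ b)] =
    (let q := (p * eval_letter phi psi (Gen K x b))%g in
     (f p + f q) * (g q - g p) + (f q + f p) * (g p - g q))%R.
    rewrite /= addr0 -mulgA; case: b => /=; by rewrite ?mulgV ?mulVg mulg1.
  by rewrite /=; ring.
- rewrite integral_cat !integral_spell eval_spell fcH gcH gmulfM -mulgA; ring.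
Qed.

Lemma integralV p w : integral (p * ev w) (wordV w) = (- integral p w)%R.
Proof.
have := integral_eqF p (eqF_mulV w); rewrite integral_cat /= => /eqP.
by rewrite addrC addr_eq0 => /eqP.
Qed.

Lemma integral_conj p u r : ev r = 1 ->
  integral p (wordV u ++ r ++ u) = integral (p * (ev u)^-1) r.
Proof.
move=> r1; rewrite !integral_cat eval_wordV r1 mulg1.
set q := p * _; have -> : p = q * ev u by rewrite /q -mulgA mulVg mulg1.
by rewrite integralV; ring.
Qed.

Definition vertices (p : L) (w : word K X) : set L :=
  [set x | exists u v, w = u ++ v /\ x = p * ev u].

Lemma vertices_first p w : vertices p w p.
Proof. by exists [::], w; rewrite eval_nil mulg1. Qed.

Lemma vertices_last p w : vertices p w (p * ev w).
Proof. by exists w, [::]; rewrite cats0. Qed.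

Lemma vertices_cons p a w x :
  vertices (p * eval_letter phi psi a) w x -> vertices p (a :: w) x.
Proof.
move=> [u [v [-> ->]]]; exists (a :: u), v; split=> //.
by rewrite eval_cons mulgA.
Qed.

Lemma integral_const_l (c : int) p w :
  (forall x, vertices p w x -> f x = c /\ forall i, fc i x = c) ->
  integral p w = (2 * c * (g (p * ev w)%g - g p))%R.
Proof.
elim: w p => [|a w IHw] p hc; first by rewrite eval_nil mulg1 /=; ring.
rewrite /= IHw; last by move=> x /vertices_cons; exact: hc.
rewrite eval_cons mulgA.
have [fp fcp] := hc p (vertices_first _ _).
have [fq _] := hc _ (vertices_cons (vertices_first _ _)).
by case: a fq {hc} => [x b|i h] /= fq; rewrite fp fq ?fcp; ring.
Qed.

Lemma integral_const_r (c : int) p w :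
  (forall x, vertices p w x -> g x = c /\ forall i, gc i x = c) ->
  integral p w = 0%R.
Proof.
elim: w p => [|a w IHw] p hc //=.
rewrite /= IHw; last by move=> x /vertices_cons; exact: hc.
have [gp gcp] := hc p (vertices_first _ _).
have [gq _] := hc _ (vertices_cons (vertices_first _ _)).
by case: a gq {hc} => [x b|i h] /= gq; rewrite gp gq ?gcp; ring.
Qed.

Section Bound.
Hypothesis f_lip : forall p a, (`|f (p * eval_letter phi psi a)%g - f p| <= 1)%R.
Hypothesis g_lip : forall p a, (`|g (p * eval_letter phi psi a)%g - g p| <= 1)%R.
Hypothesis fc_lip : forall p i, (`|fc i p - f p| <= 1)%R.
Hypothesis gc_lip : forall p i, (`|gc i p - g p| <= 1)%R.

Lemma integral_letter_bound (c r : int) p a : (`|f p - c| <= r)%R ->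
  (`|integral_letter p a - 2 * c * (g (p * eval_letter phi psi a)%g - g p)|
     <= 4 * r + 4)%R.
Proof.
have small (x y z : int) : (`|x| <= z -> `|y| <= 1 -> `|x * y| <= z)%R.
  move=> xz y1; rewrite normrM; apply: le_trans xz.
  by rewrite ler_piMr.
move=> fp; case: a (f_lip p a) (g_lip p a) => [x b|i h] /=; set q := (p * _)%g => fq gq.
  have -> : ((f p + f q) * (g q - g p) - 2 * c * (g q - g p) =
    (f p + f q - 2 * c) * (g q - g p))%R by ring.
  by apply: small => //; lia.
have := fc_lip p i; have := gc_lip p i; have := gc_lip q i.
rewrite /q gcH -/q; move: (fc i p) (gc i p) => v w gw gv fv.
have -> : ((f p + v) * (w - g p) + (v + f q) * (g q - w) - 2 * c * (g q - g p) =
   (f p + v - 2 * c) * (w - g p) + (v + f q - 2 * c) * (g q - w))%R by ring.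
have h1 : (`|(f p + v - 2 * c) * (w - g p)| <= 2 * r + 1)%R by apply: small; lia.
have h2 : (`|(v + f q - 2 * c) * (g q - w)| <= 2 * r + 2)%R by apply: small; lia.
by apply: le_trans (ler_normD _ _) _; lia.
Qed.

(** The subtracted term telescopes along the word and replaces [f] by [f - c]. This deviation grows
    by at most 1 per letter, whence a bound quadratic in the length. *)
Lemma integral_bound (c r : int) p w : (`|f p - c| <= r)%R ->
  (`|integral p w - 2 * c * (g (p * ev w)%g - g p)|
     <= 4 * (size w)%:Z * (r + (size w)%:Z))%R.
Proof.
elim: w p r => [|a w IHw] p r fp.
  by rewrite /= eval_nil mulg1 subrr mulr0 subrr normr0 mulr0 mul0r.
rewrite eval_cons mulgA /=; have := integral_letter_bound a fp.
have := f_lip p a; set q := (p * _)%g => fq ha.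
have hq : (`|f q - c| <= r + 1)%R by lia.
have := IHw q _ hq; move: ha.
set A := integral_letter _ _; set B := integral _ _; set s := size w => ha hb.
have -> : (A + B - 2 * c * (g (q * ev w)%g - g p) =
  (A - 2 * c * (g q - g p)) + (B - 2 * c * (g (q * ev w)%g - g q)))%R by ring.
apply: le_trans (ler_normD _ _) _; apply: le_trans (lerD ha hb) _.
by rewrite -[s.+1]addn1 PoszD; nia.
Qed.

(** With [c = f p] the correction vanishes because [g] returns to its initial value; the bound is
    thus independent of the base point and of the size of [f]. *)
Lemma integral_loop_bound p w : ev w = 1 ->
  (`|integral p w| <= 4 * (size w)%:Z ^+ 2)%R.
Proof.
move=> w1; have := @integral_bound (f p) 0 p w.
by rewrite subrr normr0 w1 mulg1 subrr mulr0 subr0 add0r -mulrA -expr2; apply.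
Qed.

End Bound.
End Integral.

(** * Truncated distances to a side and to cosets *)

Section Distance.
Variables (S : set L) (t : nat).

Definition near (k : nat) (p : L) : Prop :=
  exists u : word K X, (size u <= k)%N /\ S (p * ev u).

Definition near_coset (i : I) (k : nat) (p : L) : Prop :=
  exists h : K i, near k (p * phi i h).

Definition dist (p : L) : int := truncmin t (near^~ p).
Definition dist_coset (i : I) (p : L) : int := truncmin t ((near_coset i)^~ p).

Lemma nearW k p : near k p -> near k.+1 p.
Proof. by move=> [u [uk Su]]; exists u; split=> //; exact: leqW. Qed.

Lemma near_mul k p v : near k p -> near (size v + k) (p * ev v).
Proof.
move=> [u [uk Su]]; exists (wordV v ++ u).
rewrite size_cat size_rev size_map leq_add2l; split=> //.
by rewrite eval_word_cat eval_wordV mulgA mulgK.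
Qed.

Lemma near_letter k p a : near k p -> near k.+1 (p * eval_letter phi psi a).
Proof.
by move/(near_mul [:: a]); rewrite eval_cons eval_nil mulg1.
Qed.

Lemma near_letterV k p a : near k (p * eval_letter phi psi a) -> near k.+1 p.
Proof.
move/(near_mul (wordV [:: a])).
by rewrite eval_wordV eval_cons eval_nil mulg1 mulgK.
Qed.

Lemma near_near_coset i k p : near k p -> near_coset i k p.
Proof. by exists 1; rewrite gmulf1 mulg1. Qed.

(** Moving within a coset costs one letter, and nothing if [h = 1], which no letter spells. *)
Lemma near_cosetS i k p : near_coset i k p -> near k.+1 p.
Proof.
move=> [h]; case: (eqVneq h 1) => [->|h1]; first by rewrite gmulf1 mulg1 => /nearW.
exact: (@near_letterV _ _ (Per X (exist _ h h1))).
Qed.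

Lemma dist_cosetM i p (h : K i) : dist_coset i (p * phi i h) = dist_coset i p.
Proof.
congr truncmin; apply/funext => k; apply/propext; split=> -[h' nh'].
  by exists (h * h'); rewrite gmulfM mulgA.
by exists (h^-1 * h'); rewrite gmulfM mulgA -[_ * _ * phi i h^-1]mulgA -gmulfM mulgV
  gmulf1 mulg1.
Qed.

Lemma truncmin_lip2 Q Q' :
  (forall j, Q j -> Q' j.+1) -> (forall j, Q' j -> Q j.+1) ->
  (`|truncmin t Q - truncmin t Q'| <= 1)%R.
Proof. by move=> /(truncmin_lip t) h /(truncmin_lip t) h'; lia. Qed.

Lemma dist_lip p a : (`|dist (p * eval_letter phi psi a)%g - dist p| <= 1)%R.
Proof. by apply: truncmin_lip2 => j; [exact: near_letterV|exact: near_letter]. Qed.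

Lemma dist_coset_lip p i : (`|dist_coset i p - dist p| <= 1)%R.
Proof.
apply: truncmin_lip2 => j; first exact: near_cosetS.
by move=> /nearW; exact: near_near_coset.
Qed.

Lemma dist0 p : S p -> dist p = 0%R /\ forall i, dist_coset i p = 0%R.
Proof.
move=> Sp; have n0 k : near k p by exists [::]; rewrite eval_nil mulg1.
by split=> [|i]; apply: truncmin0 => j //; exact: near_near_coset.
Qed.

Lemma dist_far p : ~ near t p -> dist p = Posz t /\ forall i, dist_coset i p = Posz t.
Proof.
move=> far.
have far' k : (k <= t)%N -> ~ near k p.
  move=> kt [u [uk Su]]; apply: far; exists u; split=> //; exact: leq_trans kt.
split=> [|i]; apply: truncmin_max => j jt; first exact/far'/ltnW.
(* Passing from the coset to the point costs 1, and [j.+1 <= t]; this is why the hypothesis excludes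
   distance [t] itself. *)
by move/near_cosetS; exact: far'.
Qed.

End Distance.

(* With [f] and [g] the truncated distances to the first two sides, [f dg]
   integrates to [0] along sides 1, 2 and 4 and to [t1 t2] along side 3. *)
Lemma rectangle_integral (t1 t2 : nat) (a1 a2 a3 a4 : word K X) :
  let p1 := ev a1 in let p2 := p1 * ev a2 in let p3 := p2 * ev a3 in
  let S1 := vertices 1 a1 in let S2 := vertices p1 a2 in
  ev (a1 ++ a2 ++ a3 ++ a4) = 1 ->
  (forall x, vertices p2 a3 x -> ~ near S1 t1 x) ->
  (forall x, vertices p3 a4 x -> ~ near S2 t2 x) ->
  integral (dist S1 t1) (dist S2 t2) (dist_coset S1 t1) (dist_coset S2 t2) 1
    (a1 ++ a2 ++ a3 ++ a4) = (2 * t1%:Z * t2%:Z)%R.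
Proof.
move=> p1 p2 p3 S1 S2 w1 far1 far2.
rewrite !integral_cat !mul1g -/p1 -/p2 -/p3.
rewrite (@integral_const_l _ _ _ _ 0); last by move=> x /dist0.
rewrite (@integral_const_r _ _ _ _ 0 p1); last by move=> x /dist0.
rewrite (@integral_const_r _ _ _ _ (Posz t2) p3); last by move=> x /far2/dist_far.
rewrite (@integral_const_l _ _ _ _ (Posz t1) p2); last by move=> x /far1/dist_far.
(* The ends of side 3 lie on sides 4 and 2, so the second distance rises from 0 to [t2] along it. *)
rewrite -/p3 (proj1 (dist_far (far2 _ (vertices_first _ _)))).
rewrite (proj1 (dist0 _ (vertices_last _ _))).
ring.
Qed.

End WordIntegral.

(** * Area, shortcuts and the integral bound *)

Section Area.
Variables (G : groupType) (Lam : Type) (H : Lam -> groupClosed G).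
Variable P : relative_presentation H.
Local Notation relword := (relword H (rp_gen P)).
Local Notation phi := (fun l => \val : UMagmaMorphism.type (peripheral H l) G).
Local Notation psi := (fun x : rp_gen P => \val x).
Local Notation ev := (eval_word phi psi).

Lemma eps_of_word (w : relword) : eps (of_word w) = ev w.
Proof. exact: lift_of_word. Qed.

Lemma of_wordV (w : relword) : of_word (wordV w) = (of_word w)^-1.
Proof.
by apply: (mulgI (of_word w)); rewrite mulgV -of_wordM; exact/of_wordP/eqF_mulV.
Qed.

Lemma eval_rel r : rp_rel (r := P) r -> ev r = 1.
Proof.
move=> Pr; rewrite -eps_of_word -/([set f | eps f = 1] (of_word r)) rp_ker.
by move=> N [_]; apply; exists r.
Qed.

Lemma area_leW (w : relword) k k' : (k <= k')%N -> area_le w k -> area_le w k'.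
Proof. by move=> kk' [s [sk sR ws]]; exists s; split=> //; exact: leq_trans kk'. Qed.

Lemma area_eqF (u v : relword) k : eqF u v -> area_le u k -> area_le v k.
Proof. by move=> /of_wordP uv [s [sk sR us]]; exists s; rewrite -uv. Qed.

Lemma area_cat (u v : relword) k l :
  area_le u k -> area_le v l -> area_le (u ++ v) (k + l).
Proof.
move=> [s [sk sR us]] [s' [sl s'R vs']]; exists (s ++ s'); split.
- by rewrite size_cat leq_add.
- by move=> p; rewrite mem_cat => /orP[/sR|/s'R].
- by rewrite of_wordM us vs' big_cat.
Qed.

Lemma area_conj (u w : relword) k :
  area_le w k -> area_le (wordV u ++ w ++ u) k.
Proof.
move=> [s [sk sR ws]]; exists [seq (p.1 * of_word u, p.2) | p <- s]; split.
- by rewrite size_map.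
- by move=> _ /mapP[p /sR pR ->].
- rewrite !of_wordM of_wordV ws big_map mulgA; elim: s {sk sR ws} => [|p s IHs].
    by rewrite !big_nil mulg1 mulVg.
  rewrite !big_cons -IHs invgM /= !mulgA; congr (_ * _ * _).
  by rewrite -!mulgA mulgV mulg1.
Qed.

(** In the free product, [a b c] equals [a u c] times the conjugate of [u^-1 b] by [c]. *)
Lemma area_shortcut (a b c u : relword) k l : ev u = ev b ->
  area_le (a ++ u ++ c) k -> area_le (wordV u ++ b) l ->
  area_le (a ++ b ++ c) (k + l).
Proof.
move=> ub ak bl; apply: area_eqF (area_cat ak (area_conj c bl)).
apply/of_wordP; rewrite !of_wordM !of_wordV !mulgA.
by rewrite !mulgK.
Qed.

(** The integral depends only on the element of the free product. Along a product of conjugates the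
    conjugators cancel, and each relator contributes at most [4 * M ^ 2], wherever it is based. *)
Lemma area_integral (f g : G -> int) (fc gc : Lam -> G -> int) (M k : nat)
    (p : G) (w : relword) :
  (forall l x (h : peripheral H l), fc l (x * val h) = fc l x) ->
  (forall l x (h : peripheral H l), gc l (x * val h) = gc l x) ->
  (forall p a, (`|f (p * eval_letter phi psi a)%g - f p| <= 1)%R) ->
  (forall p a, (`|g (p * eval_letter phi psi a)%g - g p| <= 1)%R) ->
  (forall p l, (`|fc l p - f p| <= 1)%R) ->
  (forall p l, (`|gc l p - g p| <= 1)%R) ->
  (forall r, rp_rel (r := P) r -> (size r <= M)%N) ->
  area_le w k ->
  (`|integral phi psi f g fc gc p w| <= 4 * (M ^ 2 * k)%N%:Z)%R.
Proof.
move=> fcH gcH f_lip g_lip fc_lip gc_lip relM [s [sk sR]].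
have mono : (4 * (M ^ 2 * size s)%N%:Z <= 4 * (M ^ 2 * k)%N%:Z :> int)%R.
  by rewrite ler_pM2l // lez_nat leq_mul2l sk orbT.
move=> ws; apply: le_trans mono.
elim: s {sk} sR p w ws => [|[c r] s IHs] sR p w.
  rewrite big_nil => /of_wordP/(integral_eqF psi f g fcH gcH p)->.
  by rewrite normr0 muln0 mulr0.
rewrite big_cons /=.
have {IHs} IHs := IHs (fun q qs => sR q (mem_behead (s := (c, r) :: s) qs)).
have Rr : rp_rel (r := P) r by exact: (sR (c, r) (mem_head _ _)).
set x := \prod_(p <- s) _ in IHs * => ws.
have /of_wordP/(integral_eqF psi f g fcH gcH p)-> :
    of_word w = of_word ((wordV (repr c) ++ r ++ repr c) ++ repr x).
  by rewrite !of_wordM of_wordV !of_word_repr mulgA.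
rewrite integral_cat (integral_conj f g fcH gcH _ _ (eval_rel Rr)).
apply: le_trans (ler_normD _ _) _.
apply: le_trans (lerD (integral_loop_bound gcH f_lip g_lip fc_lip gc_lip _
  (eval_rel Rr)) (IHs _ _ (of_word_repr x))) _.
have := relM _ Rr; rewrite -(leq_sqr _ M) => hM.
by rewrite mulnS PoszD mulrDr lerD2r ler_pM2l // -PoszM mulnn.
Qed.

Lemma area_rectangle (M k t1 t2 : nat) (a1 a2 a3 a4 : relword) :
  (forall r, rp_rel (r := P) r -> (size r <= M)%N) ->
  ev (a1 ++ a2 ++ a3 ++ a4) = 1 ->
  area_le (a1 ++ a2 ++ a3 ++ a4) k ->
  (forall x, vertices phi psi (ev (a1 ++ a2)) a3 x ->
    ~ near phi psi (vertices phi psi 1 a1) t1 x) ->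
  (forall x, vertices phi psi (ev (a1 ++ a2 ++ a3)) a4 x ->
    ~ near phi psi (vertices phi psi (ev a1) a2) t2 x) ->
  (t1 * t2 <= 2 * M ^ 2 * k)%N.
Proof.
move=> relM w1 wk; rewrite !eval_word_cat mulgA => far1 far2.
set S1 := vertices _ _ 1 a1 in far1; set S2 := vertices _ _ (ev a1) a2 in far2.
have := area_integral 1 (dist_cosetM phi psi S1 t1)
  (dist_cosetM phi psi S2 t2) (dist_lip phi psi S1 t1) (dist_lip phi psi S2 t2)
  (dist_coset_lip phi psi S1 t1) (dist_coset_lip phi psi S2 t2) relM wk.
by rewrite (rectangle_integral w1 far1 far2); lia.
Qed.

(** Cut [w] into three sides of length [m] and a remaining one of length at least [m]. Without a
    shortcut, opposite sides are more than [t] apart, contradicting [area_rectangle]. Both [b] and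
    its complement contain a whole side, hence the last two bounds. *)
Lemma exists_shortcut (M k t m : nat) (w : relword) :
  (forall r, rp_rel (r := P) r -> (size r <= M)%N) ->
  ev w = 1 -> area_le w k -> (2 * M ^ 2 * k < t * t)%N -> (4 * m <= size w)%N ->
  exists a b c u, [/\ w = a ++ b ++ c, ev u = ev b, (size u <= t)%N,
    (m <= size b)%N & (m + size b <= size w)%N].
Proof.
move=> relM w1 wk kt mw.
set a1 := take m w; set a2 := take m (drop m w).
set a3 := take m (drop m (drop m w)); set a4 := drop m (drop m (drop m w)).
have wE : w = a1 ++ a2 ++ a3 ++ a4 by rewrite !cat_take_drop.
have s1 : size a1 = m by rewrite size_takel //; lia.
have s2 : size a2 = m by rewrite size_takel // size_drop; lia.
have s3 : size a3 = m by rewrite size_takel // !size_drop; lia.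
have s4 : (m <= size a4)%N by rewrite !size_drop; lia.
apply: contrapT => noshort.
suff : (t * t <= 2 * M ^ 2 * k)%N by rewrite leqNgt kt.
rewrite wE in w1 wk noshort; apply: area_rectangle relM w1 wk _ _.
(* A path from side 3 to side 1: [b] contains [a2] and its complement contains [a4]. *)
- move=> x [u3 [v3 [E3 ->]]] [u [ut [u1 [v1 [E1]]]]].
  rewrite mul1g => E; apply: noshort.
  exists u1, (v1 ++ a2 ++ u3), (v3 ++ a4), (wordV u); split.
  + by rewrite E1 E3 -!catA.
  + apply: (mulgI (ev u1)); rewrite -[in LHS]E eval_wordV mulgK E1.
    by rewrite !eval_word_cat !mulgA.
  + by rewrite size_rev size_map.
  + by rewrite !size_cat; lia.
  + by rewrite !size_cat; move: s1 s3; rewrite E1 E3 !size_cat; lia.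
(* A path from side 4 to side 2: [b] contains [a3] and its complement contains [a1]. *)
- move=> x [u4 [v4 [E4 ->]]] [u [ut [u2 [v2 [E2]]]]].
  move=> E; apply: noshort.
  exists (a1 ++ u2), (v2 ++ a3 ++ u4), v4, (wordV u); split.
  + by rewrite E2 E4 -!catA.
  + apply: (mulgI (ev (a1 ++ u2))); rewrite [in LHS]eval_word_cat -E.
    rewrite eval_wordV mulgK E2.
    by rewrite !eval_word_cat !mulgA.
  + by rewrite size_rev size_map.
  + by rewrite !size_cat; lia.
  + by rewrite !size_cat; move: s1 s2 s4; rewrite E2 E4 !size_cat; lia.
Qed.

End Area.

(** * Real inequalities behind the recursion *)

Section Numerics.
Variable R : realType.
Implicit Types b n k y z t : R.
Local Open Scope ring_scope.

(** The gain from concavity: the square of the right side is at least [n + 2 * n / 5], and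
    [(59 / 50) ^ 2 < 7 / 5]. *)
Lemma sqrt_split n y z : 0 <= n -> n / 5 <= y -> n / 5 <= z -> n <= y + z ->
  59 / 50 * Num.sqrt n <= Num.sqrt y + Num.sqrt z.
Proof.
move=> n0 ny nz nyz.
have y0 : 0 <= y by lra.
have z0 : 0 <= z by lra.
have := sqr_sqrtr n0; have := sqr_sqrtr y0; have := sqr_sqrtr z0.
have := sqrtr_ge0 n; have := sqrtr_ge0 y; have := sqrtr_ge0 z.
move: (Num.sqrt n) (Num.sqrt y) (Num.sqrt z) => r p q q0 p0 r0 qz py rn.
have pq : r ^+ 2 / 5 <= p * q.
  rewrite -(@ler_pXn2r _ 2) ?nnegrE ?mulr_ge0 ?invr_ge0 ?exprn_ge0 //.
  have -> : (p * q) ^+ 2 = y * z by rewrite exprMn py qz.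
  by rewrite rn expr2; apply: ler_pM; lra.
rewrite rn in pq.
rewrite -(@ler_pXn2r _ 2) ?nnegrE ?addr_ge0 ?mulr_ge0 //; last by lra.
by rewrite sqrrD py qz exprMn rn -mulr_natr expr2; lra.
Qed.

(** Otherwise [t - 1 >= n / 100], which is impossible because [10 * 32 ^ 2 > 100 ^ 2]. *)
Lemma shortcut_small n t : 100 <= n -> 10 * (32 * (t - 1)) ^+ 2 <= n ^+ 2 ->
  50 * t <= n.
Proof.
move=> n100 tn; rewrite leNgt; apply/negP => nt.
have : (n / 100) ^+ 2 <= (t - 1) ^+ 2 by rewrite ler_pXn2r ?nnegrE //; lra.
have : 0 < n ^+ 2 by rewrite exprn_gt0 //; lra.
by move: tn; rewrite !exprMn; lra.
Qed.

(** A loop of length [n] and area [k] is split into loops of lengths [y] and [z] by a path of length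
    at most [t]. The excess length costs at most [2 * A * t], while the square roots gain a multiple
    of [A * b * Num.sqrt n]; if the bound failed, [t] would be too large for a shortcut of order
    [Num.sqrt k]. *)
Lemma area_recursion (A C : R) b n k y z t :
  0 < C -> 32 <= b -> A * C = b ^+ 2 -> 5 * b ^+ 2 <= n ->
  n / 5 <= y -> n / 5 <= z -> n <= y + z -> y + z <= n + 2 * t ->
  (32 * (t - 1)) ^+ 2 <= C * k -> 10 * (C * k) <= n ^+ 2 ->
  k <= (A * y - A * b / 2 * Num.sqrt y) + (A * z - A * b / 2 * Num.sqrt z) ->
  k <= A * n - A * b / 2 * Num.sqrt n.
Proof.
move=> C0 b32 AC bn ny nz nyz yzt tk kn kyz.
have b2 : 32 * 32 <= b ^+ 2 by rewrite expr2 ler_pM.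
have n100 : 100 <= n by lra.
have n0 : 0 <= n by lra.
have A0 : 0 < A by rewrite -(pmulr_lgt0 A C0) AC; lra.
have t50 : 50 * t <= n by apply: shortcut_small => //; lra.
have := sqrt_split n0 ny nz nyz; have := sqr_sqrtr n0; have := sqrtr_ge0 n.
move: (Num.sqrt n) (Num.sqrt y) (Num.sqrt z) kyz => r p q kyz r0 rn pqr.
have b0 : 0 < b by lra.
have Ab0 : 0 < A * b by rewrite mulr_gt0.
have h1 : A * b * (59 / 50 * r) <= A * b * (p + q) by rewrite ler_pM2l.
have h2 : A * (y + z) <= A * (n + 2 * t) by rewrite ler_pM2l.
have h3 : A * (50 * t) <= A * n by rewrite ler_pM2l.
rewrite leNgt; apply/negP => kn'.
have r3 : 3 <= r.
  by rewrite -(@ler_pXn2r _ 2) ?nnegrE // rn expr2; lra.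
have br : 32 * 3 <= b * r by rewrite ler_pM.
(* The gain [A * b / 2 * (9 / 50 * r)] must be less than the cost [2 * A * t]. *)
have t1 : 9 / 200 * (b * r) < t.
  by rewrite -(ltr_pM2l A0); lra.
have Abr : 0 <= A * b * r by rewrite mulr_ge0 // ltW.
have k1 : k <= 26 / 25 * (A * n) by lra.
have k2 : C * k <= C * (26 / 25 * (A * n)) by rewrite ler_pM2l.
have k3 : C * (26 / 25 * (A * n)) = 26 / 25 * (b * r) ^+ 2.
  by rewrite exprMn rn -AC; ring.
(* Here [26 / 25 <= (51 / 50) ^ 2]. The resulting bound on [t - 1] contradicts [t1]:
   [51 / 1600 < 9 / 200], and [b * r >= 96] makes the gap exceed 1. *)
have : (32 * (t - 1)) ^+ 2 <= (51 / 50 * (b * r)) ^+ 2.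
  apply: le_trans tk _; apply: le_trans k2 _; rewrite k3 [leRHS]exprMn.
  by rewrite ler_wpM2r ?sqr_ge0 // expr2; lra.
rewrite ler_pXn2r ?nnegrE //; lra.
Qed.

(** In this range [n ^ 2 <= 5 * A * C * n] gives [k <= A * n / 2], and [b <= Num.sqrt n] makes the
    subtracted term at most [A * n / 2]. *)
Lemma area_base (A C : R) b n k : 0 < C -> 0 < A -> 0 <= b -> A * C = b ^+ 2 ->
  b ^+ 2 <= n -> n <= 5 * b ^+ 2 ->
  10 * (C * k) <= n ^+ 2 -> k <= A * n - A * b / 2 * Num.sqrt n.
Proof.
move=> C0 A0 b0 AC bn nb kn.
have n0 : 0 <= n by apply: le_trans bn; exact: sqr_ge0.
have h1 : n ^+ 2 <= 5 * (A * C) * n by rewrite AC expr2 ler_wpM2r.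
have k1 : C * k <= C * (A * n / 2) by lra.
rewrite ler_pM2l // in k1.
have br : b <= Num.sqrt n.
  by rewrite -(@ler_pXn2r _ 2) ?nnegrE ?sqrtr_ge0 // sqr_sqrtr.
have h2 : b * Num.sqrt n <= n.
  by rewrite -[leRHS](sqr_sqrtr n0) expr2 ler_wpM2r ?sqrtr_ge0.
have h3 : A * (b * Num.sqrt n) <= A * n by rewrite ler_pM2l.
lra.
Qed.

End Numerics.

Lemma natural_sqrt x : exists s, (s * s <= x < s.+1 * s.+1)%N.
Proof.
have ex : exists s, (x < s.+1 * s.+1)%N by exists x; nia.
exists (ex_minn ex); case: ex_minnP => s -> min_s; rewrite andbT.
by case: s min_s => // s min_s; rewrite leqNgt; apply/negP => /min_s; rewrite ltnn.
Qed.

(** * From small quadratic area to linear area *)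

Section LinearArea.
Variables (R : realType) (G : groupType) (Lam : Type) (H : Lam -> groupClosed G).
Variable P : relative_presentation H.
Local Notation relword := (relword H (rp_gen P)).
Local Notation phi := (fun l => \val : UMagmaMorphism.type (peripheral H l) G).
Local Notation psi := (fun x : rp_gen P => \val x).
Local Notation ev := (eval_word phi psi).
Variable M : nat.
Hypothesis relM : forall r, rp_rel (r := P) r -> (size r <= M)%N.
Local Notation C0 := (2 * M ^ 2 + 1)%N.

Lemma minimal_area (w : relword) k : area_le w k ->
  exists2 k', area_le w k' & forall l, area_le w l -> (k' <= l)%N.
Proof.
move=> wk; have ex : exists k, `[< area_le w k >] by exists k; exact/asboolP.
case: (ex_minnP ex) => k' /asboolP wk' min_k'; exists k' => // l wl.
exact/min_k'/asboolP.
Qed.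

Lemma sublinear_area (A b : nat) :
  (0 < A)%N -> (32 <= b)%N -> (A * (32 * 32 * C0) = b ^ 2)%N ->
  (forall w : relword, ev w = 1 -> (b ^ 2 <= size w)%N ->
    exists2 k, area_le w k & (10 * (32 * 32 * C0 * k) <= size w ^ 2)%N) ->
  forall w : relword, ev w = 1 -> (b ^ 2 <= size w)%N ->
    exists2 k, area_le w k &
      (k%:R <= A%:R * (size w)%:R - A%:R * b%:R / 2 * Num.sqrt (size w)%:R :> R)%R.
Proof.
set C := (32 * 32 * C0)%N => A0 b32 AC small w.
have CR0 : (0 < C%:R :> R)%R by rewrite ltr0n /C addn1.
have ACR : (A%:R * C%:R = b%:R ^+ 2 :> R)%R by rewrite -natrM AC natrX.
move: {2}(size w) (leqnn (size w)) => n; elim: n w => [|n IHn] w wn w1 bw.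
  by move: bw b32; nia.
have [k0 wk0 k0w] := small w w1 bw.
(* Minimality will give [k <= k1 + k2] when the loop is cut in two. *)
have [k wk min_k] := minimal_area wk0.
have kw : (10 * (C%:R * k%:R) <= (size w)%:R ^+ 2 :> R)%R.
  rewrite -natrX -!natrM ler_nat; apply: leq_trans k0w.
  by rewrite !leq_mul2l min_k ?orbT.
exists k => //; have [wb|bw5] := leqP (size w) (5 * b ^ 2).
  apply: area_base kw => //; rewrite ?ltr0n ?ler0n -?natrX ?ler_nat //.
  by rewrite -natrM ler_nat.
(* The shortcut length [s.+1] is the least whose square exceeds [2 * M ^ 2 * k]; the factor
   [32 * 32] in [C] makes it small compared with the loop. *)
have [s /andP[sk ks]] := natural_sqrt (2 * M ^ 2 * k).
have skC : ((32 * (s.+1%:R - 1)) ^+ 2 <= C%:R * k%:R :> R)%R.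
  rewrite -[s.+1]addn1 natrD addrK -natrM -natrX -natrM ler_nat.
  by rewrite /C; move: sk; nia.
have w100 : (100 <= size w)%N by move: b32 bw5; nia.
have s50 : (50 * s.+1 <= size w)%N.
  rewrite -(ler_nat R) natrM; apply: shortcut_small; first by rewrite ler_nat.
  by apply: le_trans kw; rewrite ler_pM2l.
have [|x [y [z [u [wE uy us xy yw]]]]] :=
  exists_shortcut (m := (size w %/ 4)%N) relM w1 wk ks; first by lia.
have xuz1 : ev (x ++ u ++ z) = 1 by rewrite -w1 wE !eval_word_cat uy.
have uy1 : ev (wordV u ++ y) = 1 by rewrite eval_word_cat eval_wordV uy mulVg.
have sV : size (wordV u) = size u by rewrite size_rev size_map.
have sw : size w = (size x + (size y + size z))%N by rewrite wE !size_cat.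
(* Each part has length at least a fifth of [size w], hence at least [b ^ 2], and is shorter than
   [w] since [u] has length at most [size w / 50]. *)
have [||k1 xuzk k1E] := IHn _ _ xuz1; [by rewrite !size_cat; lia..|].
have [||k2 uyk k2E] := IHn _ _ uy1; [by rewrite size_cat sV; lia..|].
have kk : (k <= k1 + k2)%N by apply: min_k; rewrite wE; exact: area_shortcut uyk.
apply: (area_recursion (t := s.+1%:R) CR0 _ ACR _ _ _ _ _ skC kw
  (le_trans _ (lerD k1E k2E))).
- by rewrite ler_nat.
- by rewrite -natrX -natrM ler_nat ltnW.
- by rewrite ler_pdivrMr // -natrM ler_nat !size_cat; lia.
- by rewrite ler_pdivrMr // -natrM ler_nat !size_cat sV; lia.
- by rewrite -natrD ler_nat !size_cat sV; lia.
- by rewrite -natrM -!natrD ler_nat !size_cat sV; lia.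
- by rewrite -natrD ler_nat.
Qed.

Lemma linear_area (n0 : nat) :
  (forall w : relword, ev w = 1 -> (n0 <= size w)%N ->
    exists2 k, area_le w k & (10 * (32 * 32 * C0 * k) <= size w ^ 2)%N) ->
  exists A m : nat, forall w : relword, ev w = 1 -> (m <= size w)%N ->
    area_le w (A * size w).
Proof.
(* These values give [A * (32 * 32 * C0) = b ^ 2] with [b >= 32] and [b ^ 2 >= n0]. *)
move=> small; set b := (32 * C0 * n0.+1)%N; set A := (C0 * n0.+1 ^ 2)%N.
exists A, (b ^ 2)%N => w w1 bw.
have bn0 : (n0 <= b ^ 2)%N by rewrite /b; nia.
have [||||k wk] := @sublinear_area A b _ _ _ _ w w1 bw.
- by rewrite /A; nia.
- by rewrite /b; nia.
- by rewrite /A /b; ring.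
- by move=> v v1 /(leq_trans bn0); exact: small.
move=> kE; apply: area_leW wk; rewrite -(ler_nat R) natrM.
apply: le_trans kE _; rewrite gerBl.
by rewrite !mulr_ge0 ?invr_ge0 ?sqrtr_ge0.
Qed.

End LinearArea.

(** * Subquadratic functions and the equivalence *)

Lemma subquadratic_bound (R : realType) (f : nat -> nat) (q : nat) :
  subquadratic R f -> exists c, forall n, (q * f n <= n ^ 2 + c)%N.
Proof.
move=> /eqoP/(_ (q.+1%:R^-1)%R); rewrite invr_gt0 ltr0n => /(_ isT) [N _ hN].
(* The constant absorbs the finitely many values before the asymptotic bound sets in. *)
exists (\sum_(i < N) q * f i)%N => n; have [Nn|nN] := leqP N n.
  apply: leq_trans (leq_addr _ _); have /= := hN n Nn.
  rewrite -natrX !normr_nat mulrC ler_pdivlMr ?ltr0n // -natrM ler_nat.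
  by rewrite mulnC; apply: leq_trans; rewrite leq_mul2r leqnSn orbT.
apply: leq_trans (leq_addl _ _).
by rewrite (bigD1 (Ordinal nN)) //= leq_addr.
Qed.

Theorem corollary2p57 (R : realType) (G : groupType) (Lam : Type)
    (H : Lam -> groupClosed G)
    (P : relative_presentation H) (finP : finite_presentation P)
    (d : nat -> nat) (Pd : is_relative_dehn P d)
    (delta : nat -> nat) (delta_d : dehn_equiv delta d) :
  subquadratic R delta <-> linearly_bounded delta.
Proof.
split=> [sub|[L deltaL]]; last first.
  (* Beyond [L / e], one has [L * n <= e * n ^ 2]. *)
  apply/eqoP => e e0; exists (Num.bound (L%:R / e)%R) => //= n /= Nn.
  rewrite -natrX !normr_nat natrX.
  have := archi_boundP (divr_ge0 (ler0n R L) (ltW e0)).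
  rewrite ltr_pdivrMr // => /ltW LN.
  apply: (@le_trans _ _ (L%:R * n%:R)%R); first by rewrite -natrM ler_nat.
  rewrite expr2 mulrA ler_wpM2r //; apply: le_trans LN _.
  by rewrite mulrC ler_pM2l // ler_nat.
have [M relM] : exists M, forall r, rp_rel (r := P) r -> (size r <= M)%N.
  have [_ /finite_seqP[rs rsE]] := finP.
  exists (\sum_(r <- rs) size r)%N => r Pr.
  have rrs : r \in rs by have : [set` rs] r by rewrite -rsE.
  by rewrite (big_rem r) //= leq_addr.
have [[C1 [K [L deltale]]] [C2 [K' [L' dle]]]] := delta_d.
have [d_iso d_min] := Pd.
set C0 := (2 * M ^ 2 + 1)%N.
(* The factor [K' ^ 2 + 1] absorbs the rescaling of the argument. Using 20 for the required 10
   leaves room for a second [n ^ 2], which bounds [c] and the linear term once [n] reaches the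
   threshold [n0] below. *)
have [c dc] := subquadratic_bound (20 * (32 * 32 * C0) * C2 * (K' ^ 2 + 1)) sub.
have [|A [m lin]] := linear_area R relM (n0 := (c + 20 * (32 * 32 * C0) * L' + 1)%N).
  move=> w w1 nw; exists (d (size w)).
    by apply: d_iso => //; rewrite /represents1 eps_of_word.
  rewrite -/C0; set C := (32 * 32 * C0)%N in dc nw *.
  have := dle (size w); have := dc (K' * size w)%N; move: nw.
  move: (size w) => n nw dcn dn.
  have h1 : (20 * C * C2 * delta (K' * n) <= n ^ 2 + c)%N.
    rewrite -(leq_pmul2r (m := K' ^ 2 + 1)) ?addn1 //.
    by move: dcn; rewrite expnMn addn1; nia.
  have h2 : (20 * C * d n <= 20 * C * C2 * delta (K' * n) + 20 * C * L' * n)%N.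
    have : (20 * C * d n <= 20 * C * (C2 * delta (K' * n) + L' * n))%N.
      by rewrite leq_mul2l dn orbT.
    by rewrite mulnDr !mulnA.
  have h3 : ((c + 20 * C * L' + 1) * n <= n ^ 2)%N.
    by rewrite -mulnn leq_mul2r nw orbT.
  nia.
have dL n : (d n <= (A + d m) * n)%N.
  apply: (d_min (fun n => (A + d m) * n)%N) => {}n w wn w1.
  have [mw|wm] := leqP m (size w).
    apply: area_leW (lin w _ mw); last by rewrite -eps_of_word.
    by rewrite leq_mul ?leq_addr.
  (* The empty word needs no relators; a nonempty short word has area at most [d m], hence at most
     [d m * n] as [n >= 1]. *)
  case: w wn w1 wm => [|a w] wn w1 wm; first by exists [::]; rewrite big_nil.
  apply: area_leW (d_iso m _ (ltnW wm) w1).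
  by move: wn => /=; case: n => // n _; rewrite mulnS mulnDl; nia.
exists (C1 * (A + d m) * K + L)%N => n; apply: leq_trans (deltale n) _.
rewrite mulnDl leq_add2r -!mulnA leq_mul2l.
by rewrite (leq_trans (dL _)) ?orbT.
Qed.
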